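(* The $B$-sequence is the only nontrivial slow sequence resulting from a recurrence $B_k$ with an initial condition of the form $B_k(i)=i$ for all $i\leq N$, for some $N$. That is: the $B$-sequence is such a slow sequence (it arises with $k=3$, $N=5$), and if for some integers $k\geq 1$ and $N\geq 1$ the sequence generated by the recurrence $$B_k(n)=\sum_{i=1}^k B_k(n-B_k(n-i))\qquad (n>N)$$ with the initial condition $B_k(i)=i$ for $1\leq i\leq N$ is slow, then this sequence is either the trivial all-ones sequence or the $B$-sequence.
   Context: A sequence is called slow if it is infinite (defined at every positive integer index), monotone (weakly) increasing, and each successive difference is $0$ or $1$. For the recurrence $B_k$ with the given initial condition, the term $B_k(n)$ with $n>N$ is defined only if every index occurring in the recurrence (each $n-i$ and each $n-B_k(n-i)$, $1\le i\le k$) lies in $\{1,\dots,n-1\}$ and $B_k$ is defined there; otherwise $B_k(n)$ and all subsequent terms fail to exist, the sequence is finite, and it is not slow. The $B$-sequence $(B(n))_{n\geq 1}$ is defined by $B(i)=i$ for $1\leq i\leq 5$ and $B(n)=B(n-B(n-1))+B(n-B(n-2))+B(n-B(n-3))$ for $n\geq 6$. The trivial sequence is the all-ones sequence (arising from $k=1$, $N=1$); ''nontrivial'' means different from it. *)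

(* Defs.v *)
(* MathComp world. *)
From mathcomp Require Import all_boot.

Set Implicit Arguments.
Unset Strict Implicit.
Unset Printing Implicit Defensive.

(* A possibly finite sequence, indexed from 1: [u n = None] means that the
   n-th term does not exist. Index 0 is never a term. *)
Definition pseq := nat -> option nat.

(* The term of index [j] when the terms of indices 1, ..., [size s] are listed
   in [s]; it exists only for 1 <= j <= size s. *)
Definition term (s : seq nat) (j : nat) : option nat :=
  if 0 < j <= size s then Some (nth 0 s j.-1) else None.

(* Strict addition, unlike [oAC addn]: an undefined summand makes the sum
   undefined. *)
Definition oadd (x y : option nat) : option nat :=
  if x is Some a then if y is Some b then Some (a + b) else None else None.

(* B(n - B(n - i)), where [s] lists B(1), ..., B(n - 1). Truncated subtraction
   is harmless: a nonpositive index becomes 0, at which [term] is undefined,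
   and the index n - 0 = n exceeds [size s]. *)
Definition nested (s : seq nat) (n i : nat) : option nat :=
  obind (fun v => term s (n - v)) (term s (n - i)).

(* The first [n] terms of the sequence with B(i) = i for i <= N, where for
   n > N the term B(n) is [rule s n], with [s] listing the earlier terms.
   Once a term is undefined, there are no further ones. *)
Fixpoint prefix_of (N : nat) (rule : seq nat -> nat -> option nat) (n : nat) :
    option (seq nat) :=
  if n is m.+1 then
    obind (fun s => omap (rcons s) (if n <= N then Some n else rule s n))
          (prefix_of N rule m)
  else Some [::].

Definition generated (N : nat) (rule : seq nat -> nat -> option nat) : pseq :=
  fun n => obind (fun s => term s n) (prefix_of N rule n).

Definition Bk (k N : nat) : pseq :=
  generated N
    (fun s n => \big[oadd/Some 0]_(1 <= i < k.+1) nested s n i).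

Definition B_seq : pseq :=
  generated 5
    (fun s n => oadd (oadd (nested s n 1) (nested s n 2)) (nested s n 3)).

Definition trivial_seq : pseq := fun n => if 0 < n then Some 1 else None.

Definition slow (u : pseq) : Prop :=
  (forall n, 0 < n -> exists a, u n = Some a) /\
  (forall n a b, 0 < n -> u n = Some a -> u n.+1 = Some b ->
     a <= b /\ (b - a = 0 \/ b - a = 1)).

(* Main.v *)
Require Import Defs.
From mathcomp Require Import all_boot zify.

(** Every sequence that matters here is total, so the option-valued sequences
    are first traded for functions [u : nat -> nat] satisfying [solves k N u].

    Slowness of the B-sequence.  Let [P v] be the index of the first occurrence
    of [v].  In the B-sequence every value occurs once or twice, with
    multiplicities
        mult (3m+1) = 1,   mult (3m+2) = mult (m+1),   mult (3m+3) = 2   (m >= 1),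
    which amounts to the recursion [first_occ_eq] for [P].  Conversely, take this
    recursion as the definition of [P] and let [B v] be the slow sequence
    whose value on [P v, P (v+1)) is [v].  Around the indices where the value is
    3m+1, 3m+2 or 3m+3 the arguments n - B(n-i) all fall within distance one of
    P (m+1), where B is m, m+1 or m+2, and the recurrence is checked case by case
    ([Btot_solves]).

    Uniqueness.  Let T = 1 + ... + k.  The first generated term B(N+1) is T, so
    slowness forces N = T or N + 1 = T, and in both cases the sequence is the one
    with N = T.  For k = 1 it is constant, for k = 3 it is the B-sequence, and for
    k = 2 the term of index 11 exceeds its predecessor by 2.  For k >= 4 put
    q = T - k.  As long as all the arguments n - B(n-i) stay at most T, the
    sequence is u (T + 1 + a (k+1) + r) = T + a k + r with r <= k
    ([solution_regular]).  The argument T + 1 is met at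
    n0 = T + 1 + q (k+1) + k; since u (T+1) = T, the next k terms can
    be computed as well ([solution_after], [solution_stall]), and the term of
    index n0 + k exceeds its predecessor by 2 ([no_slow_ge4]).  For k = 3 this
    last jump does not happen because one more argument, q + 4, equals T + 1. *)

Set Implicit Arguments.
Unset Strict Implicit.
Unset Printing Implicit Defensive.

(** * Partial and total sequences *)

Lemma termE (u : nat -> nat) n j :
  term (mkseq (fun i => u i.+1) n) j = if 0 < j <= n then Some (u j) else None.
Proof.
rewrite /term size_mkseq; case: ifP => // /andP[j0 jn].
by rewrite nth_mkseq ?prednK.
Qed.

Lemma nestedE (u : nat -> nat) n i :
  nested (mkseq (fun i => u i.+1) n) n.+1 i =
  if (0 < i <= n) && (0 < u (n.+1 - i) <= n) then Some (u (n.+1 - u (n.+1 - i)))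
  else None.
Proof.
rewrite /nested termE.
have -> : (0 < n.+1 - i <= n) = (0 < i <= n) by lia.
case: ifP => //= _; rewrite termE.
by have -> : (0 < n.+1 - u (n.+1 - i) <= n) = (0 < u (n.+1 - i) <= n) by lia.
Qed.

Lemma prefix_total N rule (u : nat -> nat) n :
  (forall m, 0 < m -> generated N rule m = Some (u m)) ->
  prefix_of N rule n = Some (mkseq (fun i => u i.+1) n).
Proof.
move=> gen; elim: n => [//|n IHn].
have := gen n.+1 isT; rewrite /generated /= IHn /=.
case: (if _ then _ else _) => [x|] //=.
rewrite /term size_rcons size_mkseq ltnSn /= nth_rcons size_mkseq ltnn eqxx.
by case=> ->; rewrite mkseqS.
Qed.

Lemma generated_eq N rule (u : nat -> nat) :
  (forall i, 0 < i <= N -> u i = i) ->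
  (forall n, N <= n -> rule (mkseq (fun i => u i.+1) n) n.+1 = Some (u n.+1)) ->
  forall n, 0 < n -> generated N rule n = Some (u n).
Proof.
move=> init step.
have pref n : prefix_of N rule n = Some (mkseq (fun i => u i.+1) n).
  elim: n => [//|n IHn]; rewrite /= IHn /=.
  have -> : (if n < N then Some n.+1 else rule (mkseq (fun i => u i.+1) n) n.+1)
            = Some (u n.+1).
    by case: ltnP => [lt_nN|/step//]; rewrite init.
  by rewrite /= mkseqS.
by move=> n n0; rewrite /generated pref /= termE n0 leqnn.
Qed.

Lemma generated0 N rule : generated N rule 0 = None.
Proof. by []. Qed.

Lemma eq_generated N rule1 rule2 :
  (forall s n, rule1 s n = rule2 s n) -> generated N rule1 =1 generated N rule2.
Proof.
move=> eq12 n; rewrite /generated; congr obind.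
elim: n => [//|n IHn] /=; rewrite IHn.
by case: (prefix_of _ _ _) => //= s; rewrite eq12.
Qed.

Lemma big_oadd_some (r : seq nat) (F : nat -> option nat) x :
  \big[oadd/Some 0]_(i <- r) F i = Some x ->
  x = \sum_(i <- r) odflt 0 (F i) /\ {in r, forall i, F i != None}.
Proof.
elim: r x => [|j r IHr] x; first by rewrite !big_nil => -[<-].
rewrite !big_cons; case Fj: (F j) => [y|] //=.
case E: (\big[_/_]_(_ <- _) _) => [z|] //= [<-].
have [-> Fr] := IHr _ E; split=> // i; rewrite inE => /orP[/eqP->|/Fr//].
by rewrite Fj.
Qed.

(** [u] obeys the recurrence B_k with initial condition u i = i for i <= N.
    No condition is put on the indices n - u (n - i): the existence of the terms
    is accounted for separately. *)
Definition solves (k N : nat) (u : nat -> nat) : Prop :=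
  (forall i, 0 < i <= N -> u i = i) /\
  (forall n, N < n -> u n = \sum_(1 <= i < k.+1) u (n - u (n - i))).

(** A slow sequence is given by a total solution; the existence of the term of index
    N + 1 forces k <= N. *)
Lemma slow_solution k N :
  0 < k -> slow (Bk k N) ->
  exists u : nat -> nat,
    [/\ forall n, 0 < n -> Bk k N n = Some (u n), solves k N u, k <= N &
        forall n, 0 < n -> u n <= u n.+1 <= (u n).+1].
Proof.
move=> k0 [def mono]; pose u n := odflt 0 (Bk k N n).
have uE n : 0 < n -> Bk k N n = Some (u n).
  by move=> n0; rewrite /u; have [a ->] := def n n0.
have pref n := prefix_total n uE.
have init i : 0 < i <= N -> u i = i.
  case: i => [//|n] /andP[_ lt_nN]; have := pref n.+1.
  by rewrite /= pref /= lt_nN mkseqS => -[/rcons_inj[]].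
have step n : N <= n ->
    \big[oadd/Some 0]_(1 <= i < k.+1) nested (mkseq (fun i => u i.+1) n) n.+1 i
    = Some (u n.+1).
  move=> le_Nn; have := pref n.+1; rewrite /= pref /= ltnNge le_Nn /=.
  case: (\big[_/_]_(_ <= _ < _) _) => [x|] //=.
  by rewrite mkseqS => -[/rcons_inj[->]].
exists u; split=> //.
- split=> // -[//|n] le_Nn.
  have [-> Fr] := big_oadd_some (step n le_Nn).
  apply: eq_big_seq => i /Fr; rewrite nestedE; by case: ifP.
- have [_ /(_ k)] := big_oadd_some (step N (leqnn N)).
  rewrite mem_index_iota k0 ltnSn nestedE => /(_ isT).
  by case: ifP => // /andP[/andP[]].
- move=> n n0; have := mono n _ _ n0 (uE n n0) (uE n.+1 isT); lia.
Qed.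

(** * The B-sequence *)

(** The index of the first occurrence of [v] in the B-sequence, by recursion on
    [v] with fuel [d]; the recursive calls are at smaller values. *)
Fixpoint first_occ_rec (d v : nat) : nat :=
  if d is d'.+1 then
    if v <= 3 then v else
    let m := v.-1 %/ 3 in
    if v.-1 %% 3 == 0 then 3 * m + first_occ_rec d' m.+1 - 1 else
    if v.-1 %% 3 == 1 then 3 * m + first_occ_rec d' m.+1 else
    3 * m + first_occ_rec d' m.+2
  else v.

Definition first_occ (v : nat) : nat := first_occ_rec v v.

(** Fuel [v] suffices for the argument [v]. *)
Lemma first_occ_recE d v : v <= d -> first_occ_rec d v = first_occ v.
Proof.
rewrite /first_occ => le_vd.
suff fuel e : v <= e -> first_occ_rec d v = first_occ_rec e v by apply: fuel.
elim: d e v le_vd => [|d IHd] [|e] v le_vd le_ve //=.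
- by case: ifP; lia.
- by case: ifP; lia.
- by case: ifP => // v3; rewrite !(IHd e) //; lia.
Qed.

Lemma first_occ_eq m : 0 < m ->
  [/\ first_occ (3 * m).+1 = 3 * m + first_occ m.+1 - 1,
      first_occ (3 * m).+2 = 3 * m + first_occ m.+1 &
      first_occ (3 * m).+3 = 3 * m + first_occ m.+2].
Proof.
move=> m0.
have unfold v : 3 < v -> first_occ v =
    let p := v.-1 %/ 3 in
    if v.-1 %% 3 == 0 then 3 * p + first_occ p.+1 - 1 else
    if v.-1 %% 3 == 1 then 3 * p + first_occ p.+1 else 3 * p + first_occ p.+2.
  case: v => [//|v] v3; rewrite {1}/first_occ /= ifF; last lia.
  by rewrite !first_occ_recE //; lia.
have D : [/\ (3 * m) %/ 3 = m, (3 * m).+1 %/ 3 = m & (3 * m).+2 %/ 3 = m].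
  by split; lia.
have R : [/\ (3 * m) %% 3 = 0, (3 * m).+1 %% 3 = 1 & (3 * m).+2 %% 3 = 2].
  by split; lia.
case: D R => D0 D1 D2 [R0 R1 R2].
by split; rewrite unfold /= ?D0 ?D1 ?D2 ?R0 ?R1 ?R2 //; lia.
Qed.

Lemma block3 b v : 3 * b < v -> exists2 m, b <= m &
  [\/ v = (3 * m).+1, v = (3 * m).+2 | v = (3 * m).+3].
Proof.
move=> bv; exists (v.-1 %/ 3); first lia.
have: v.-1 %% 3 < 3 by lia.
case E: (v.-1 %% 3) => [|[|[|]]] // _;
  [constructor 1 | constructor 2 | constructor 3]; lia.
Qed.

Lemma first_occ_gap v : 0 < v -> first_occ v < first_occ v.+1 <= (first_occ v).+2.
Proof.
elim/ltn_ind: v => v IHv v0.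
have [v4|v4] := ltnP v 4; first by case: v v4 v0 {IHv} => [|[|[|[|]]]].
have [m m0 vE] := @block3 1 v v4.
have [E1 E2 E3] := first_occ_eq m0; have [E4 _ _] := first_occ_eq (ltn0Sn m).
rewrite mulnSr addn3 in E4.
have IH1 := IHv m.+1; have IH2 := IHv m.
case: vE => vE; subst v; lia.
Qed.

Lemma first_occ_ge v : v <= first_occ v.
Proof.
elim: v => [//|[//|v] IHv]; have := @first_occ_gap v.+1 isT; lia.
Qed.

Lemma first_occ_mono v w : 0 < v <= w -> first_occ v <= first_occ w.
Proof.
case/andP=> v0; elim: w => [|w IHw]; first lia.
rewrite leq_eqVlt => /orP[/eqP<- //|vw].
have := @first_occ_gap w; have := IHw vw; lia.
Qed.

(** The slow sequence in which the value [v] first occurs at index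
    [first_occ v], obtained by counting the values that occurred so far. *)
Definition Btot (n : nat) : nat := \sum_(1 <= v < n.+1) (first_occ v <= n).

Lemma BtotE v n : 0 < v -> first_occ v <= n < first_occ v.+1 -> Btot n = v.
Proof.
move=> v0 /andP[le_vn lt_nv]; have vn := leq_trans (first_occ_ge v) le_vn.
rewrite /Btot (@big_cat_nat _ _ _ v.+1) //=.
rewrite (@eq_big_nat _ _ _ 1 v.+1 _ (fun=> 1)); last first.
  move=> i iv; have := @first_occ_mono i v; lia.
rewrite (@eq_big_nat _ _ _ v.+1 n.+1 _ (fun=> 0)); last first.
  move=> i iv; have := @first_occ_mono v.+1 i; lia.
by rewrite !sum_nat_const_nat; lia.
Qed.

Lemma first_occ_bracket n : 0 < n ->
  exists2 v, 0 < v & first_occ v <= n < first_occ v.+1.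
Proof.
elim: n => [//|[|n] IHn] _; first by exists 1.
have [v v0 vn] := IHn isT.
have [lt_nv|le_vn] := ltnP n.+2 (first_occ v.+1); first by exists v => //; lia.
by exists v.+1 => //; have := @first_occ_gap v.+1; lia.
Qed.

Lemma Btot_pos n : 0 < n -> 0 < Btot n <= n.
Proof.
move=> n0; have [v v0 vn] := first_occ_bracket n0.
by rewrite (BtotE v0 vn); have := first_occ_ge v; lia.
Qed.

Lemma Btot_slow n : 0 < n -> Btot n <= Btot n.+1 <= (Btot n).+1.
Proof.
move=> n0; have [v v0 vn] := first_occ_bracket n0; rewrite (BtotE v0 vn).
have [lt_nv|le_vn] := ltnP n.+1 (first_occ v.+1).
  by rewrite (@BtotE v) //; lia.
by rewrite (@BtotE v.+1) //; have := @first_occ_gap v.+1; lia.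
Qed.

Lemma Btot_rec n : 5 < n ->
  Btot n = Btot (n - Btot (n - 1)) + Btot (n - Btot (n - 2)) + Btot (n - Btot (n - 3)).
Proof.
move=> n5.
have [n8|n8] := ltnP n 8.
  have B1 : Btot 1 = 1 by apply: BtotE.
  have B2 : Btot 2 = 2 by apply: BtotE.
  have B3 : Btot 3 = 3 by apply: BtotE.
  have B4 : Btot 4 = 4 by apply: BtotE.
  have B5 : Btot 5 = 5 by apply: BtotE.
  have B6 : Btot 6 = 6 by apply: BtotE.
  have B7 : Btot 7 = 6 by apply: BtotE.
  have [->|->] : n = 6 \/ n = 7 by lia.
  - by rewrite /= B3 B4 B5 B6 ?subSS ?subn0 B1 B2 B3.
  - by rewrite /= B4 B5 B6 B7 ?subSS ?subn0 B1 B2 B3.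
have [v v0 vn] := first_occ_bracket (ltn_trans (ltn0Sn 4) n5).
rewrite (BtotE v0 vn).
have v7 : 6 < v.
  rewrite ltnNge; apply/negP => v6.
  have := @first_occ_mono v.+1 7; have -> : first_occ 7 = 8 by []. lia.
have [m m1 vE] := @block3 2 v v7.
have m0 := ltnW m1.
(* The first occurrences of the values 3m-1, 3m, 3m+1, 3m+2, 3m+3, 3m+4. *)
have [E1 E2 E3] := first_occ_eq m0; have [E4 _ _] := first_occ_eq (ltn0Sn m).
have m'0 : 0 < m.-1 by lia.
have [_ F2 F3] := first_occ_eq m'0.
have mE : (3 * m.-1).+3 = 3 * m by lia.
have m'E : (3 * m.-1).+2 = (3 * m).-1 by lia.
rewrite mE prednK // in F3; rewrite m'E prednK // in F2.
rewrite mulnSr addn3 in E4.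
have G0 := first_occ_gap m0.
have G1 := first_occ_gap (ltn0Sn m); have G2 := first_occ_gap (ltn0Sn m.+1).
have P1 := first_occ_ge m.+1.
set p := first_occ m.+1 in E1 E2 E3 F3 G0 G1 P1.
have A0 : Btot p.-1 = m by apply: BtotE => //; lia.
have A1 : Btot p = m.+1 by apply: BtotE => //; lia.
have V0 j : first_occ (3 * m).-1 <= j < first_occ (3 * m) -> Btot j = (3 * m).-1.
  by move=> jP; apply: BtotE; rewrite ?prednK; lia.
have V1 j : first_occ (3 * m) <= j < first_occ (3 * m).+1 -> Btot j = 3 * m.
  by apply: BtotE; lia.
have V2 j : first_occ (3 * m).+1 <= j < first_occ (3 * m).+2 -> Btot j = (3 * m).+1.
  by apply: BtotE.
have V3 j : first_occ (3 * m).+2 <= j < first_occ (3 * m).+3 -> Btot j = (3 * m).+2.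
  by apply: BtotE.
have V4 j : first_occ (3 * m).+3 <= j < first_occ (3 * m).+4 -> Btot j = (3 * m).+3.
  by apply: BtotE.
(* The value m+1, first met at p, occurs once or twice, which decides the value
   at p + 1 and the length of the block of indices n of values 3m+1 to 3m+3. *)
have [once|twice] : first_occ m.+2 = p.+1 \/ first_occ m.+2 = p.+2 by lia.
- have A2 : Btot p.+1 = m.+2 by apply: BtotE => //; lia.
  have [nE|[nE|[nE|nE]]] : n = 3 * m + p - 1 \/ n = 3 * m + p \/
      n = 3 * m + p.+1 \/ n = 3 * m + p.+2.
    by case: vE => vE; subst v; lia.
  + rewrite (V1 (n - 1)) ?(V1 (n - 2)) ?(V0 (n - 3)); try lia.
    have -> : n - 3 * m = p.-1 by lia.
    have -> : n - (3 * m).-1 = p by lia.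
    rewrite A0 A1; case: vE => vE; subst v; lia.
  + rewrite (V2 (n - 1)) ?(V1 (n - 2)) ?(V1 (n - 3)); try lia.
    have -> : n - 3 * m = p by lia.
    have -> : n - (3 * m).+1 = p.-1 by lia.
    rewrite A0 A1; case: vE => vE; subst v; lia.
  + rewrite (V3 (n - 1)) ?(V2 (n - 2)) ?(V1 (n - 3)); try lia.
    have -> : n - 3 * m = p.+1 by lia.
    have -> : n - (3 * m).+1 = p by lia.
    have -> : n - (3 * m).+2 = p.-1 by lia.
    rewrite A0 A1 A2; case: vE => vE; subst v; lia.
  + rewrite (V4 (n - 1)) ?(V3 (n - 2)) ?(V2 (n - 3)); try lia.
    have -> : n - (3 * m).+1 = p.+1 by lia.
    have -> : n - (3 * m).+2 = p by lia.
    have -> : n - (3 * m).+3 = p.-1 by lia.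
    rewrite A0 A1 A2; case: vE => vE; subst v; lia.
- have A2 : Btot p.+1 = m.+1 by apply: BtotE => //; lia.
  have [nE|[nE|[nE|[nE|nE]]]] : n = 3 * m + p - 1 \/ n = 3 * m + p \/
      n = 3 * m + p.+1 \/ n = 3 * m + p.+2 \/ n = 3 * m + p.+3.
    by case: vE => vE; subst v; lia.
  + rewrite (V1 (n - 1)) ?(V1 (n - 2)) ?(V0 (n - 3)); try lia.
    have -> : n - 3 * m = p.-1 by lia.
    have -> : n - (3 * m).-1 = p by lia.
    rewrite A0 A1; case: vE => vE; subst v; lia.
  + rewrite (V2 (n - 1)) ?(V1 (n - 2)) ?(V1 (n - 3)); try lia.
    have -> : n - 3 * m = p by lia.
    have -> : n - (3 * m).+1 = p.-1 by lia.
    rewrite A0 A1; case: vE => vE; subst v; lia.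
  + rewrite (V3 (n - 1)) ?(V2 (n - 2)) ?(V1 (n - 3)); try lia.
    have -> : n - 3 * m = p.+1 by lia.
    have -> : n - (3 * m).+1 = p by lia.
    have -> : n - (3 * m).+2 = p.-1 by lia.
    rewrite A0 A1 A2; case: vE => vE; subst v; lia.
  + rewrite (V3 (n - 1)) ?(V3 (n - 2)) ?(V2 (n - 3)); try lia.
    have -> : n - (3 * m).+1 = p.+1 by lia.
    have -> : n - (3 * m).+2 = p by lia.
    rewrite A1 A2; case: vE => vE; subst v; lia.
  + rewrite (V4 (n - 1)) ?(V3 (n - 2)) ?(V3 (n - 3)); try lia.
    have -> : n - (3 * m).+2 = p.+1 by lia.
    have -> : n - (3 * m).+3 = p by lia.
    rewrite A1 A2; case: vE => vE; subst v; lia.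
Qed.

Lemma Btot_solves : solves 3 5 Btot.
Proof.
split=> [i i5|n n5].
  by case: i i5 => [|[|[|[|[|[|i]]]]]] // _; apply: BtotE.
by rewrite (Btot_rec n5) /index_iota /= !big_cons big_nil addn0 addnA.
Qed.

Lemma Btot6 : Btot 6 = 6.
Proof. exact: BtotE. Qed.

Lemma B_seqE n : 0 < n -> B_seq n = Some (Btot n).
Proof.
have [init rec] := Btot_solves; apply: generated_eq => // m m5.
rewrite rec // /index_iota /= !big_cons big_nil addn0 addnA !nestedE.
have bnd j : 0 < j <= 3 -> (0 < j <= m) && (0 < Btot (m.+1 - j) <= m).
  by move=> j3; have := @Btot_pos (m.+1 - j); lia.
by rewrite !bnd.
Qed.

Lemma slow_B_seq : slow B_seq.
Proof.
split=> [n n0|n a b n0]; first by exists (Btot n); apply: B_seqE.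
by rewrite !B_seqE // => -[<-] [<-]; have := Btot_slow n0; lia.
Qed.

Lemma Bk35 : Bk 3 5 =1 B_seq.
Proof.
apply: eq_generated => s n; rewrite /index_iota /= !big_cons big_nil.
case: (nested s n 1) => [a|] //; case: (nested s n 2) => [b|] //.
by case: (nested s n 3) => [c|] //=; rewrite addn0 addnA.
Qed.

Lemma solves_unique k N (u v : nat -> nat) :
  (forall n, 0 < n -> 0 < v n <= n) -> k <= N ->
  solves k N u -> solves k N v -> forall n, 0 < n -> u n = v n.
Proof.
move=> vb kN [iu ru] [iv rv]; elim/ltn_ind => n IHn n0.
have [nN|Nn] := leqP n N; first by rewrite iu ?iv ?n0.
rewrite ru // rv //; apply: eq_big_nat => i ik.
have vi := vb (n - i); rewrite (IHn (n - i)) ?IHn //; lia.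
Qed.

(** * Uniqueness *)

(** The sums met below have terms c + i, with the first [r] terms raised by 1
    and the last [e] terms lowered by 1. *)
Lemma sum_pattern k r e c (F : nat -> nat) : r <= k -> e <= k ->
  (forall i, 0 < i <= k -> F i + (k < i + e) = c + i + (i <= r)) ->
  \sum_(1 <= i < k.+1) F i + e = c * k + \sum_(1 <= i < k.+1) i + r.
Proof.
move=> rk ek FE.
have count b : b <= k -> \sum_(1 <= i < k.+1) (i <= b) = b.
  move=> bk; rewrite (@big_cat_nat _ _ _ b.+1) //=.
  rewrite (@eq_big_nat _ _ _ 1 b.+1 _ (fun=> 1)); last by move=> i; lia.
  rewrite (@eq_big_nat _ _ _ b.+1 k.+1 _ (fun=> 0)); last by move=> i; lia.
  by rewrite !sum_nat_const_nat; lia.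
have -> : \sum_(1 <= i < k.+1) F i + e =
          \sum_(1 <= i < k.+1) (F i + (k < i + e)).
  rewrite big_split /=; congr (_ + _); rewrite big_nat_rev /= -[LHS]count //.
  by apply: eq_big_nat => i; lia.
under eq_big_nat => i ik do rewrite FE //.
by rewrite !big_split /= count // sum_nat_const_nat; lia.
Qed.


(** The sum 1 + ... + k, which is the first term B(N+1) following the initial
    condition. *)
Definition tri (k : nat) : nat := \sum_(1 <= i < k.+1) i.

Lemma triS k : tri k.+1 = tri k + k.+1.
Proof. by rewrite /tri big_nat_recr. Qed.

Lemma tri_ge k : k <= tri k.
Proof. by case: k => [//|k]; rewrite triS leq_addl. Qed.

Lemma solution_pattern k (u : nat -> nat) n r e c :
  solves k (tri k) u -> tri k < n -> r <= k -> e <= k ->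
  (forall i, 0 < i <= k -> u (n - u (n - i)) + (k < i + e) = c + i + (i <= r)) ->
  u n + e = c * k + tri k + r.
Proof. by move=> [_ rec] nT rk ek FE; rewrite rec //; apply: sum_pattern. Qed.

(** The regular regime, in which all arguments n - u (n - i) are at most
    [tri k]: every (k+1)-st difference is 0 and the others are 1. *)
Lemma solution_regular k (u : nat -> nat) a r :
  solves k (tri k) u -> r <= k -> a + k + (k <= r) <= tri k ->
  u (tri k + 1 + a * k.+1 + r) = tri k + a * k + r.
Proof.
move=> su; have [init _] := su.
elim: a r => [|a IHa]; elim/ltn_ind => r IHr rk ar; rewrite -[LHS]addn0.
- rewrite (@solution_pattern k u _ r 0 0 su) ?mul0n //; first lia; first lia.
  move=> i ik; have -> : nat_of_bool (k < i + 0) = 0 by lia.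
  have [ir|ri] := leqP i r.
  + have -> : tri k + 1 + 0 + r - i = tri k + 1 + 0 * k.+1 + (r - i) by lia.
    rewrite IHr; [|lia..].
    rewrite init; lia.
  + rewrite (init (_ - i)); last lia.
    rewrite init; lia.
- rewrite (@solution_pattern k u _ r 0 a.+1 su) ?addn0 //; first lia; first lia.
  move=> i ik; have -> : nat_of_bool (k < i + 0) = 0 by lia.
  have [ir|ri] := leqP i r.
  + have -> : tri k + 1 + a.+1 * k.+1 + r - i = tri k + 1 + a.+1 * k.+1 + (r - i) by lia.
    rewrite IHr; [|lia..].
    rewrite init; lia.
  + have -> : tri k + 1 + a.+1 * k.+1 + r - i = tri k + 1 + a * k.+1 + (k.+1 + r - i).
      by rewrite mulSn; lia.
    rewrite IHa; [|lia..].
    rewrite init; lia.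
Qed.

(** Values at small arguments: u is the identity up to [tri k], and the value
    [tri k] is repeated once. *)
Lemma solution_small k (u : nat -> nat) x :
  1 < k -> solves k (tri k) u -> 0 < x <= tri k + 2 -> u x + (tri k < x) = x.
Proof.
move=> k1 su xP; have [init _] := su.
have [xT|xT] := leqP x (tri k); first by rewrite init //; lia.
have kT := tri_ge k.
have [->|->] : x = tri k + 1 + 0 * k.+1 + 0 \/ x = tri k + 1 + 0 * k.+1 + 1 by lia.
- by rewrite solution_regular //; lia.
- by rewrite solution_regular //; lia.
Qed.

(** The first index n0 for which [tri k + 1] is among the arguments
    n0 - u (n0 - i); it is the argument for i = k. *)
Definition turn (k : nat) : nat := tri k + 1 + (tri k - k) * k.+1 + k.

(** The term of index n0 equals its predecessor; the next k - 2 differences are 1. *)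
Lemma solution_after k (u : nat -> nat) s :
  3 < k -> solves k (tri k) u -> s <= k - 2 ->
  u (turn k + s) = tri k + (tri k - k) * k + k - 1 + s.
Proof.
move=> k4 su; have kT := tri_ge k; set q := tri k - k.
elim/ltn_ind: s => s IHs sk.
have : u (turn k + s) + 1 = q.+1 * k + tri k + s; last by rewrite mulSn; lia.
apply: solution_pattern; rewrite // ?/turn -/q; try lia.
move=> i ik; rewrite -[tri k + 1 + _ + k]/(turn k).
have -> : turn k + s - u (turn k + s - i) = q.+1 + i + (i <= s).
  have [si|si] := leqP i s.
  - have -> : turn k + s - i = turn k + (s - i) by lia.
    by rewrite IHs /turn -/q ?mulnS; lia.
  - have -> : turn k + s - i = tri k + 1 + q * k.+1 + (k + s - i).
      by rewrite /turn -/q; lia.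
    by rewrite (solution_regular su) /turn -/q ?mulnS; lia.
by have := @solution_small k u (q.+1 + i + (i <= s)) _ su; lia.
Qed.

(** At the index n0 + k - 1 the arguments for i = k - 1 and i = k both equal
    [tri k + 1], and the term equals its predecessor. *)
Lemma solution_stall k (u : nat -> nat) :
  3 < k -> solves k (tri k) u ->
  u (turn k + (k - 1)) = tri k + (tri k - k) * k + k - 1 + (k - 2).
Proof.
move=> k4 su; have kT := tri_ge k; set q := tri k - k; set s := k - 1.
have : u (turn k + s) + 2 = q.+1 * k + tri k + s; last by rewrite mulSn; lia.
apply: solution_pattern; rewrite // ?/turn -/q; try lia.
move=> i ik; rewrite -[tri k + 1 + _ + k]/(turn k).
have -> : turn k + s - u (turn k + s - i) = q.+1 + i + (i <= s).
  have [si|si] := leqP i s.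
  - have -> : turn k + s - i = turn k + (s - i) by lia.
    by rewrite solution_after // /turn -/q ?mulnS; lia.
  - have -> : turn k + s - i = tri k + 1 + q * k.+1 + (k + s - i).
      by rewrite /turn -/q; lia.
    by rewrite (solution_regular su) /turn -/q ?mulnS; lia.
by have := @solution_small k u (q.+1 + i + (i <= s)) _ su; lia.
Qed.

Lemma tri4 k : 3 < k -> k + 6 <= tri k.
Proof.
case: k => [|[|[|[|k]]]] // _; rewrite triS.
elim: k => [|k IHk]; first by rewrite /tri/index_iota /= !big_cons big_nil.
by rewrite triS; lia.
Qed.

(** At the index n0 + k the first argument is q + 4, which is at most [tri k], and
    only the last two, [tri k + 1] and [tri k + 2], are not fixed by u. *)
Lemma solution_jump k (u : nat -> nat) :
  3 < k -> solves k (tri k) u ->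
  u (turn k + k) = tri k + (tri k - k) * k + k - 1 + k.
Proof.
move=> k4 su; have kT := tri4 k4; set q := tri k - k.
have : u (turn k + k) + 2 = q.+2 * k + tri k + 1; last by rewrite !mulSn; lia.
apply: solution_pattern; rewrite // ?/turn -/q; try lia.
move=> i ik; rewrite -[tri k + 1 + _ + k]/(turn k).
have -> : turn k + k - u (turn k + k - i) = q.+2 + i + (i <= 1).
  have [i1|i1] := leqP i 1.
  - have -> : turn k + k - i = turn k + (k - 1) by lia.
    by rewrite solution_stall // /turn -/q ?mulnS; lia.
  - have -> : turn k + k - i = turn k + (k - i) by lia.
    by rewrite solution_after // /turn -/q ?mulnS; lia.
by have := @solution_small k u (q.+2 + i + (i <= 1)) _ su; lia.
Qed.

Lemma no_slow_ge4 k (u : nat -> nat) :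
  3 < k -> solves k (tri k) u ->
  ~ (forall n, 0 < n -> u n <= u n.+1 <= (u n).+1).
Proof.
move=> k4 su /(_ (turn k + (k - 1))); rewrite -addnS (_ : (k - 1).+1 = k); last lia.
by rewrite solution_stall // solution_jump //; lia.
Qed.

Lemma no_slow_2 (u : nat -> nat) :
  solves 2 3 u -> ~ (forall n, 0 < n -> u n <= u n.+1 <= (u n).+1).
Proof.
move=> [init rec] /(_ 10 isT).
have step n : 3 < n -> u n = u (n - u (n - 1)) + u (n - u (n - 2)).
  by move=> n3; rewrite rec // /index_iota /= !big_cons big_nil addn0 subn1 subn2.
have [u1 u2 u3] : [/\ u 1 = 1, u 2 = 2 & u 3 = 3] by split; apply: init.
have u4 : u 4 = 3 by rewrite step //= u3 u2 ?subSS ?subn0 u1 u2.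
have u5 : u 5 = 4 by rewrite step //= u4 u3 ?subSS ?subn0 u2.
have u6 : u 6 = 5 by rewrite step //= u5 u4 ?subSS ?subn0 u2 u3.
have u7 : u 7 = 5 by rewrite step //= u6 u5 ?subSS ?subn0 u2 u3.
have u8 : u 8 = 6 by rewrite step //= u7 u6 ?subSS ?subn0 u3.
have u9 : u 9 = 6 by rewrite step //= u8 u7 ?subSS ?subn0 u3 u4.
have u10 : u 10 = 6 by rewrite step //= u9 u8 ?subSS ?subn0 u4.
have u11 : u 11 = 8 by rewrite step //= u10 u9 ?subSS ?subn0 u5.
by rewrite u10 u11.
Qed.

(** Slowness at the end of the initial condition leaves the two values
    N = tri k and N + 1 = tri k, which give the same sequence. *)
Lemma slow_solves_tri k N (u : nat -> nat) :
  0 < k <= N -> solves k N u -> u N <= u N.+1 <= (u N).+1 ->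
  solves k (tri k) u.
Proof.
move=> /andP[k0 kN] [init rec].
have -> : u N.+1 = tri k.
  rewrite rec //; apply: eq_big_nat => i ik.
  by rewrite (init (_ - i)) ?subKn ?init; lia.
rewrite init; last lia.
move=> NT; have [NE|NE] : N = tri k \/ N.+1 = tri k by lia.
  by rewrite -NE.
rewrite -NE; split=> [i iN|n nN]; last by apply: rec; lia.
have [iN'|->] : i <= N \/ i = N.+1 by lia.
  by apply: init; lia.
rewrite rec // [RHS]NE; apply: eq_big_nat => j jk.
by rewrite (init (_ - j)) ?subKn ?init; lia.
Qed.

Theorem theorem3 :
  [/\ slow B_seq, ~ (B_seq =1 trivial_seq) & Bk 3 5 =1 B_seq] /\
  (forall k N : nat, 1 <= k -> 1 <= N ->
     slow (Bk k N) -> Bk k N =1 trivial_seq \/ Bk k N =1 B_seq).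
Proof.
split; first split.
- exact: slow_B_seq.
- by move=> /(_ 2); rewrite B_seqE // (@BtotE 2).
- exact: Bk35.
move=> k N k1 N1 /(slow_solution k1) [u [uE su kN slow_u]].
have kN' : 0 < k <= N by rewrite k1.
have suT := slow_solves_tri kN' su (slow_u N N1).
have [k4|k4] := ltnP 3 k; first by case: (no_slow_ge4 k4 suT).
case: k k1 k4 kN kN' suT su uE => [|[|[|[|]]]] // _ _ kN kN' suT su uE.
- left=> n; rewrite /trivial_seq; case: (posnP n) => [->|n0]; first exact: generated0.
  rewrite uE //; congr Some.
  have tri1 : tri 1 = 1 by rewrite /tri big_nat1.
  rewrite tri1 in suT; case: suT => init rec.
  elim/ltn_ind: n n0 => n IHn n0; have [n1|n1] := leqP n 1; first by rewrite init; lia.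
  by rewrite rec // big_nat1 IHn ?IHn; lia.
- case: (no_slow_2 _ slow_u).
  by have <- : tri 2 = 3 by rewrite /tri/index_iota /= !big_cons big_nil.
- right=> n; case: (posnP n) => [->|n0]; first by rewrite /B_seq !generated0.
  rewrite uE // B_seqE //; congr Some.
  have tri3 : tri 3 = 6 by rewrite /tri/index_iota /= !big_cons big_nil.
  rewrite tri3 in suT.
  apply: (solves_unique Btot_pos _ suT _ n0) => //; have [init rec] := Btot_solves.
  split=> [i i6|m m6]; last by apply: rec; lia.
  have [i5|->] : i <= 5 \/ i = 6 by lia.
    by apply: init; lia.
  exact: Btot6.
Qed.
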